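(* Let $a_n$ be the number of $\pi\in S_n$ avoiding both arrow patterns $(12;3\to 2)$ and $(1;1\to 1)$, with $a_0=1$ and $a_1=0$. For $n\ge 2$, \[a_n=\sum_{k=2}^{n}\binom{n-2}{k-2}(a_{k-1}+a_{k-2})=\sum_{k=0}^{n-1}\binom{n-1}{k}a_k.\]
   Context: Standard cycle form of $\sigma\in S_n$: product of disjoint cycles (fixed points included), each cycle starting with its largest element, cycles listed in increasing order of largest elements. The fundamental bijection $\theta:S_n\to S_n$ erases the parentheses of the standard cycle form to give a one-line permutation. For $\pi\in S_n$, $\hat\pi=\theta^{-1}(\pi)$. An arrow pattern $(\nu;H)$ of size $k$: a string $\nu=a_1\dots a_m$ of positive integers and a set $H$ of arrows $b\to c$, with all integers appearing forming $[k]$. $\pi\in S_n$ contains $(\nu;H)$ if there is $X=\{x_1<\dots<x_k\}\subseteq[n]$ with positions $t_1<\dots<t_m$ such that $\pi_{t_1}\cdots\pi_{t_m}=x_{a_1}\cdots x_{a_m}$ and $\hat\pi(x_b)=x_c$ for every arrow $b\to c\in H$; otherwise it avoids it. In particular $\pi$ avoids $(1;1\to1)$ iff $\hat\pi$ has no fixed points. *)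

(* Defs.v *)
From mathcomp Require Import all_boot all_fingroup.

Set Implicit Arguments.
Unset Strict Implicit.
Unset Printing Implicit Defensive.

(* [n] and [k] are encoded as 'I_n and 'I_k, that is, shifted down by one. *)

Section StandardCycleForm.

Variable n : nat.
Implicit Types (s p : 'S_n) (m i : 'I_n).

Definition cycle_max s m := [forall i in porbit s m, i <= m].

(* The cycle of s through m, written (m, s m, s (s m), ...). *)
Definition cycle_from s m : seq 'I_n := traject s m #|porbit s m|.

(* enum 'I_n is increasing, so the cycles come in increasing order of their
   largest elements. *)
Definition std_cycle_form s : seq (seq 'I_n) :=
  [seq cycle_from s m | m <- enum 'I_n & cycle_max s m].

Definition theta_word s : seq 'I_n := flatten (std_cycle_form s).

Lemma mem_cycle_from s m i : (i \in cycle_from s m) = (i \in porbit s m).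
Proof. by rewrite /cycle_from porbit_traject. Qed.

Lemma cycle_max_uniq s m1 m2 i : cycle_max s m1 -> cycle_max s m2 ->
  i \in porbit s m1 -> i \in porbit s m2 -> m1 = m2.
Proof.
move=> /forall_inP max1 /forall_inP max2 i1 i2.
have e : porbit s m1 = porbit s m2.
  by apply/eqP; rewrite -(eqP (_ : porbit s i == porbit s m1)) ?eq_porbit_mem.
apply/val_inj/anti_leq; rewrite max1 ?max2 //.
  by rewrite -e porbit_id.
by rewrite e porbit_id.
Qed.

Lemma theta_word_uniq s : uniq (theta_word s).
Proof.
rewrite /theta_word /std_cycle_form.
have: all (cycle_max s) [seq m <- enum 'I_n | cycle_max s m] by apply: filter_all.
have: uniq [seq m <- enum 'I_n | cycle_max s m] by rewrite filter_uniq ?enum_uniq.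
elim: [seq _ <- _ | _] => //= m r IH /andP[mNr ur] /andP[mmax rmax].
rewrite cat_uniq IH // andbT uniq_traject_porbit /=.
apply/hasPn => i /flattenP[_ /mapP[m' m'r ->]]; rewrite mem_cycle_from => im'.
apply/negP; rewrite /= mem_cycle_from => im.
have e := cycle_max_uniq mmax (allP rmax _ m'r) im im'.
by rewrite e m'r in mNr.
Qed.

Lemma mem_std_cycle_form s i : exists2 m, cycle_max s m & i \in cycle_from s m.
Proof.
case: (arg_maxnP val (porbit_id s i)) => m mi max_m.
have e : porbit s m = porbit s i by apply/eqP; rewrite eq_porbit_mem.
exists m; last by rewrite mem_cycle_from e porbit_id.
by apply/forall_inP => j; rewrite e; apply: max_m.
Qed.

Lemma size_theta_word s : size (theta_word s) = n.
Proof.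
rewrite -[RHS]size_enum_ord; apply/perm_size/uniq_perm.
- exact: theta_word_uniq.
- exact: enum_uniq.
move=> i; rewrite mem_enum; have [m mm im] := mem_std_cycle_form s i.
apply/flattenP; exists (cycle_from s m) => //; apply: map_f.
by rewrite mem_filter mm mem_enum.
Qed.

Definition theta_fun s : 'I_n -> 'I_n := fun i => nth i (theta_word s) i.

Lemma theta_fun_inj s : injective (theta_fun s).
Proof.
move=> i j; rewrite /theta_fun (set_nth_default i j) ?size_theta_word // => /eqP.
by rewrite nth_uniq ?size_theta_word ?theta_word_uniq // => /eqP/val_inj.
Qed.

(* The fundamental bijection: theta s is the permutation whose one-line
   notation is theta_word s. *)
Definition theta s : 'S_n := perm (@theta_fun_inj s).

Lemma theta_wordE s : theta_word s = [seq theta s i | i <- enum 'I_n].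
Proof.
case: (posnP n) => [n0|n_gt0].
  have sz0 (u : seq 'I_n) : size u = n -> u = [::].
    by move=> e; apply: size0nil; rewrite e n0.
  have -> := sz0 _ (size_theta_word s).
  by apply/esym/sz0; rewrite size_map size_enum_ord.
apply: (@eq_from_nth _ (Ordinal n_gt0)) => [|i].
  by rewrite size_map size_enum_ord size_theta_word.
rewrite size_theta_word => lti; rewrite (nth_map (Ordinal n_gt0)) ?size_enum_ord //.
rewrite -[i]/(val (Ordinal lti)) nth_ord_enum permE /theta_fun.
by apply: set_nth_default; rewrite size_theta_word.
Qed.

(* The blocks of theta_word s start at its left-to-right maxima, hence s can be
   recovered from it. *)
Definition block_head_max (b : seq 'I_n) :=
  if b is m :: r then all (fun i : 'I_n => i < m) r else false.

Definition block_lt (b c : seq 'I_n) :=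
  if (b, c) is (m :: _, m' :: _) then m < m' else false.

Lemma flatten_blocks_inj bs cs :
    all block_head_max bs -> pairwise block_lt bs ->
    all block_head_max cs -> pairwise block_lt cs ->
  flatten bs = flatten cs -> bs = cs.
Proof.
have key (m : 'I_n) (r1 r2 : seq 'I_n) t1 t2 : block_head_max (m :: r2) ->
    all block_head_max t1 -> all (block_lt (m :: r1)) t1 ->
    r1 ++ flatten t1 = r2 ++ flatten t2 -> size r1 < size r2 -> False.
  move=> lt2; case: t1 => [|[//|m' r'] t1] /=.
    move=> _ _ e; move: (congr1 size e); rewrite cats0 size_cat => ->.
    by rewrite ltnNge leq_addr.
  move=> _ /andP[mm' _] e lts.
  have := congr1 (fun u => nth m u (size r1)) e.
  rewrite !nth_cat ltnn subnn lts /= => em'.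
  have := allP lt2 _ (mem_nth m lts); rewrite -em' => m'm.
  by have := ltn_trans mm' m'm; rewrite ltnn.
elim: bs cs => [|[//|m r1] t1 IH] [|[|m2 r2] t2] //=.
move=> /andP[h1 H1] /andP[l1 L1] /andP[h2 H2] /andP[l2 L2] [em e].
rewrite -{}em {m2} in h2 l2 *.
have sz : size r1 = size r2.
  case: (ltngtP (size r1) (size r2)) => // lt.
    by case: (key m r1 r2 t1 t2).
  by case: (key m r2 r1 t2 t1).
move/eqP: e; rewrite eqseq_cat // => /andP[/eqP -> /eqP e].
by rewrite (IH t2).
Qed.

Lemma cycle_from_cons s m :
  cycle_from s m = m :: traject s (s m) #|porbit s m|.-1.
Proof. by rewrite /cycle_from; case: #|_| (card_porbit_neq0 s m). Qed.

Lemma std_cycle_form_blocks s : all block_head_max (std_cycle_form s).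
Proof.
rewrite all_map; apply/allP => m; rewrite mem_filter => /andP[/forall_inP mm _].
rewrite /= cycle_from_cons /=; apply/allP => i ir.
have : uniq (cycle_from s m) by apply: uniq_traject_porbit.
rewrite cycle_from_cons /= => /andP[mr _].
rewrite ltn_neqAle mm -?mem_cycle_from ?cycle_from_cons ?inE ?ir ?orbT // andbT.
by apply: contraNneq mr => /val_inj e; move: ir; rewrite e.
Qed.

Lemma std_cycle_form_sorted s : pairwise block_lt (std_cycle_form s).
Proof.
rewrite pairwise_map; apply: (@sub_pairwise _ (relpre val ltn)).
  by move=> m m' /=; rewrite !cycle_from_cons.
rewrite -pairwise_map -sorted_pairwise; last exact: ltn_trans.
rewrite sorted_map; apply: sorted_filter => [? ? ?|]; first exact: ltn_trans.
by rewrite -sorted_map val_enum_ord iota_ltn_sorted.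
Qed.

Lemma cycle_fromP s m : fcycle s (cycle_from s m).
Proof.
rewrite cycle_from_cons /= -[X in rcons _ X](iter_porbit s m).
case: #|_| (card_porbit_neq0 s m) => //= k _.
by rewrite -iterS iterSr -trajectSr fpath_traject.
Qed.

Lemma theta_inj : injective theta.
Proof.
move=> s1 s2 e.
have {}e : theta_word s1 = theta_word s2.
  by rewrite !theta_wordE e.
have {}e : std_cycle_form s1 = std_cycle_form s2.
  by apply: flatten_blocks_inj; rewrite ?std_cycle_form_blocks ?std_cycle_form_sorted.
apply/permP => i; have [m mm im] := mem_std_cycle_form s1 i.
have : cycle_from s1 m \in std_cycle_form s1.
  by apply: map_f; rewrite mem_filter mm mem_enum.
rewrite e => /mapP[m' _ em].
have := cycle_fromP s1 m => /next_cycle /(_ im) /eqP ->.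
by rewrite em in im *; have := cycle_fromP s2 m' => /next_cycle /(_ im) /eqP ->.
Qed.

Definition hat p : 'S_n := invF theta_inj p.

End StandardCycleForm.

(* Pattern labels are written from 1 to k, as on paper. *)
Lemma label_proof k a : 0 < a <= k -> a.-1 < k.
Proof. by case: a. Qed.

Definition label k a (ha : 0 < a <= k) : 'I_k := Ordinal (label_proof ha).

(* A pair (b, c) in pat_arrows stands for the arrow b -> c. *)
Record arrow_pattern k := ArrowPattern {
  pat_word : seq 'I_k;
  pat_arrows : {set 'I_k * 'I_k};
  pat_cover : forall i : 'I_k, i \in pat_word \/
    exists2 bc, bc \in pat_arrows & i = bc.1 \/ i = bc.2
}.

(* The increasing map x enumerates X = {x_1 < ... < x_k}, and t lists the
   positions t_1 < ... < t_m. *)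
Definition contains n k (P : arrow_pattern k) (p : 'S_n) : bool :=
  [exists x : {ffun 'I_k -> 'I_n},
   exists t : {ffun 'I_(size (pat_word P)) -> 'I_n},
    [&& [forall i : 'I_k, forall j : 'I_k, (i < j) ==> (x i < x j)],
        [forall i : 'I_(size (pat_word P)), forall j : 'I_(size (pat_word P)),
           (i < j) ==> (t i < t j)],
        [forall j, p (t j) == x (tnth (in_tuple (pat_word P)) j)]
      & [forall bc in pat_arrows P, hat p (x bc.1) == x bc.2]]].

Definition avoids n k (P : arrow_pattern k) (p : 'S_n) : bool := ~~ contains P p.

Definition pat_12_32_word : seq 'I_3 := [:: @label 3 1 isT; @label 3 2 isT].
Definition pat_12_32_arrows : {set 'I_3 * 'I_3} :=
  [set (@label 3 3 isT, @label 3 2 isT)].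

Lemma pat_12_32_cover (i : 'I_3) : i \in pat_12_32_word \/
  exists2 bc, bc \in pat_12_32_arrows & i = bc.1 \/ i = bc.2.
Proof.
case: i => [[|[|[|//]]] lti]; [by left | by left | right].
by exists (@label 3 3 isT, @label 3 2 isT); [rewrite inE | left; apply: val_inj].
Qed.

Definition pat_12_32 : arrow_pattern 3 := ArrowPattern pat_12_32_cover.

Definition pat_1_11_word : seq 'I_1 := [:: @label 1 1 isT].
Definition pat_1_11_arrows : {set 'I_1 * 'I_1} :=
  [set (@label 1 1 isT, @label 1 1 isT)].

Lemma pat_1_11_cover (i : 'I_1) : i \in pat_1_11_word \/
  exists2 bc, bc \in pat_1_11_arrows & i = bc.1 \/ i = bc.2.
Proof. by left; case: i => [[|//] lti]. Qed.

Definition pat_1_11 : arrow_pattern 1 := ArrowPattern pat_1_11_cover.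

Definition a n : nat :=
  #|[set p : 'S_n | avoids pat_12_32 p & avoids pat_1_11 p]|.

(* Main.v *)
(* Put s = hat p.  A letter x followed in the word p by y < x satisfies
   s x = y, and every arrow x -> y with y < x arises in this way.  Hence p avoids
   (12; 3 -> 2) iff every descent bottom of p is smaller than all letters before
   it, and s is then a derangement iff no left-to-right maximum of p is followed
   by another one or by the end of the word.

   Cut such a word just before its smallest letter.  The second part is
   increasing and does not contain the largest letter, and the first part is a
   word of the same kind, except that it may end with its maximum; deleting that
   maximum leaves again a word of the required kind.  With b_j = a_j + a_(j-1)
   words of length j available for the first part, choosing the letters of the
   second part among the n - 2 that are neither the smallest nor the largest
   gives the first formula, and Pascal's rule gives the second. *)

Require Import Defs.
From mathcomp Require Import all_boot all_fingroup.

Set Implicit Arguments.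
Unset Strict Implicit.
Unset Printing Implicit Defensive.

(* Reversing a permutation that avoids both patterns gives a word r, written
   from its last letter on, with [strong r]; [weak] drops only the condition
   that the last letter not be a left-to-right maximum.  Here [step r y] is the
   condition for appending y to the word whose reversal is r: either y is a new
   minimum, or it is an ascent from a letter that is not a left-to-right
   maximum. *)
Definition exceeded (r : seq nat) := has (ltn (head 0 r)) r.

Definition step (r : seq nat) y :=
  all (ltn y) r || exceeded r && (head 0 r < y).

Fixpoint weak (r : seq nat) :=
  if r is y :: r' then step r' y && weak r' else true.

Definition strong (r : seq nat) := weak r && ((r == [::]) || exceeded r).

Definition nweak s := count weak (permutations s).
Definition nstrong s := count strong (permutations s).

(** * Reversed words and their extreme letters *)

Lemma gtn_trans : transitive gtn.
Proof. by move=> y x z /= yx zy; apply: ltn_trans yx. Qed.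

(** Nothing lies below 0, so after 0 the word can only ascend and [v ++ [:: 0]] decreases. Only a
    letter of [u] can then exceed its head, and such a letter exceeds all of [v]. *)
Lemma strong_cat0 v u : all (ltn 0) (v ++ u) ->
  strong (v ++ 0 :: u) =
    [&& weak u, sorted gtn (v ++ [:: 0]) & has (ltn (head 0 (v ++ [:: 0]))) u].
Proof.
rewrite /strong /exceeded; elim: v => [|x v IH] /=.
  by move=> u_gt0; rewrite /step /= u_gt0 ?ltnn /=.
move=> /andP[x_gt0 vu_gt0]; move: (IH vu_gt0).
have -> : (v ++ 0 :: u == [::]) = false by case: (v).
rewrite ?ltnn /= /step all_cat /= ?andbF /= => e.
have -> : path gtn x (v ++ [:: 0]) =
    (head 0 (v ++ [:: 0]) < x) && sorted gtn (v ++ [:: 0]).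
  by case: (v) => //=; rewrite andbT.
have eh : head 0 (v ++ 0 :: u) = head 0 (v ++ [:: 0]) by case: (v).
rewrite /exceeded (andbAC (has _ _) (_ < _)) (andbC (has _ _) (weak _)) -andbA.
rewrite e eh.
apply/idP/idP.
  move=> /andP[/and3P[-> srt _] /andP[ltx]]; rewrite srt ltx /= has_cat /=.
  move=> /orP[|//] /hasP[z zv xz].
  have : all (gtn x) (v ++ [:: 0]).
    apply: (order_path_min gtn_trans).
    by case: (v) srt ltx => /= [_ ->|? ? -> ->].
  move/allP/(_ z); rewrite mem_cat zv => /(_ isT) /= zx.
  by have := ltn_trans zx xz; rewrite ltnn.
move=> /and3P[-> /andP[ltx ->] hx]; rewrite ltx /= has_cat /= hx !orbT andbT.
by apply/hasP; move/hasP: hx => [z zu xz]; exists z => //=; apply: ltn_trans xz.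
Qed.

(** A new largest letter can only be appended to a nonempty word as an ascent, which requires
    exactly the condition separating [strong] from [weak]. *)
Lemma weak_cons_max m r : all (gtn m) r -> weak (m :: r) = strong r.
Proof.
case: r => [|x r] //; rewrite /strong [weak (m :: _)]/= andbC => /= /andP[xm _].
by congr (_ && _); rewrite /step /= xm andbT ltnNge (ltnW xm).
Qed.

Lemma exceeded_max m r : all (geq m) r -> exceeded (m :: r) = false.
Proof.
move=> /allP r_lt; rewrite /exceeded /= ltnn /=; apply/hasPn => x /r_lt /=.
by rewrite leqNgt.
Qed.

(** * Relabelling, and weak words ending in their maximum *)

Lemma weak_map f r : {in r &, {mono f : x y / x < y}} ->
  weak (map f r) = weak r.
Proof.
elim: r => //= y r IH f_mono; rewrite {}IH; last first.
  by move=> x z xr zr; rewrite f_mono ?inE ?xr ?zr ?orbT.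
congr (_ && _); rewrite /step /exceeded; case: r f_mono => //= x r f_mono.
have xin : x \in [:: y, x & r] by rewrite !inE eqxx orbT.
have sub z : z \in r -> z \in [:: y, x & r] by rewrite !inE => ->; rewrite !orbT.
rewrite !ltnn all_map has_map /= !f_mono ?mem_head //.
congr (_ && _ || _ && _).
  by apply: eq_in_all => z zr /=; rewrite f_mono ?mem_head ?sub.
by apply: eq_in_has => z zr /=; rewrite f_mono ?(sub z).
Qed.

(** [weak] only compares letters, so the increasing bijection [f] from ranks to letters transports
    it. *)
Lemma nweak_size s : uniq s -> nweak s = nweak (iota 0 (size s)).
Proof.
move=> s_uniq; set t := sort leq s; pose f := nth 0 t.
have t_uniq : uniq t by rewrite sort_uniq.
have st : size t = size s by rewrite size_sort.
have t_lt : sorted ltn t by rewrite ltn_sorted_uniq_leq t_uniq sort_sorted //; exact: leq_total.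
have f_mono : {in gtn (size s) &, {mono f : x y / x < y}}.
  move=> i j /=; rewrite -!topredE /= -st => lti ltj.
  have lt k l : k < l -> l < size t -> f k < f l.
    move=> kl lts; apply: (sorted_ltn_nth ltn_trans) => //.
    by rewrite inE (ltn_trans kl).
  case: (ltngtP i j) => [/lt -> //|/lt ltf|->]; last by rewrite ltnn.
  by apply/negbTE; rewrite -leqNgt ltnW ?ltf.
have mf : map f (iota 0 (size s)) = t by rewrite -st -/(mkseq f _) mkseq_nth.
(* Relabelling is injective, and both lists have the same factorial length. *)
have eq_perm : perm_eq (permutations s)
    (map (map f) (permutations (iota 0 (size s)))).
  have le_size : size (permutations s) <=
      size (map (map f) (permutations (iota 0 (size s)))).
    by rewrite size_map !size_permutations ?iota_uniq ?size_iota.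
  have map_uniq : uniq (map (map f) (permutations (iota 0 (size s)))).
    rewrite map_inj_in_uniq ?permutations_uniq //.
    apply: (can_in_inj (g := map (index^~ t))) => u.
    rewrite mem_permutations => /perm_mem mu.
    rewrite -map_comp map_id_in // => i.
    by rewrite mu mem_iota /f /= => lti; rewrite index_uniq ?st.
  have sub_perm : {subset map (map f) (permutations (iota 0 (size s)))
      <= permutations s}.
    move=> _ /mapP[u + ->]; rewrite !mem_permutations => /(perm_map f).
    by rewrite mf => /perm_trans; apply; rewrite perm_sort.
  apply: uniq_perm => // [|u]; first exact: permutations_uniq.
  by case: (uniq_min_size map_uniq sub_perm le_size).
rewrite /nweak (seq.permP eq_perm) count_map; apply: eq_in_count => r /=.
rewrite mem_permutations => /perm_mem mr; apply: weak_map => x y.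
by rewrite !mr !mem_iota; apply: f_mono.
Qed.

Lemma iota0_rcons k : iota 0 k.+1 = rcons (iota 0 k) k.
Proof. by rewrite -cats1 -addn1 iotaD. Qed.

(** A weak word that is not strong ends with a left-to-right maximum, hence with [k]; deleting it
    leaves a strong word by [weak_cons_max]. *)
Lemma nweakS k :
  nweak (iota 0 k.+1) = nstrong (iota 0 k.+1) + nstrong (iota 0 k).
Proof.
pose Q := predD weak strong.
have -> : nweak (iota 0 k.+1) = nstrong (iota 0 k.+1) +
    count Q (permutations (iota 0 k.+1)).
  rewrite -count_predUI (eq_count (a1 := predI strong Q) (a2 := pred0)).
    rewrite count_pred0 addn0; apply: eq_count => r /=.
    by rewrite /strong; case: (weak r); case: (r == _); case: (exceeded r).
  by move=> r /=; case: (strong r).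
congr (_ + _); rewrite /nstrong -!size_filter -[RHS](size_map (cons k)).
apply/perm_size/uniq_perm; first by rewrite filter_uniq ?permutations_uniq.
  by rewrite map_inj_uniq ?filter_uniq ?permutations_uniq // => ? ? [].
move=> r; rewrite mem_filter mem_permutations iota0_rcons.
have gt_k (u : seq nat) : perm_eq u (iota 0 k) -> all (gtn k) u.
  by move=> /perm_all->; apply/allP => i; rewrite mem_iota.
apply/idP/mapP => [/andP[/andP[]]|[u]]; last first.
  rewrite mem_filter mem_permutations => /andP[us pu] ->.
  rewrite /= -/(weak (k :: u)) weak_cons_max ?gt_k // us /strong /=.
  rewrite exceeded_max ?andbF /= 1?perm_sym ?perm_rcons ?perm_cons //.
    by rewrite perm_sym.
  by apply: sub_all (gt_k _ pu) => ? /ltnW.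
move=> nsr wr pr; case: r => [|y r] in nsr wr pr *.
  by move/perm_size: pr; rewrite size_rcons.
have yk : y = k.
  have := perm_mem pr y; rewrite mem_head mem_rcons inE mem_iota => /esym/orP[/eqP//|/= ltyk].
  case/negP: nsr; rewrite /strong wr /=; apply/hasP; exists k => //.
  by rewrite (perm_mem pr) mem_rcons mem_head.
move: pr; rewrite yk perm_sym perm_rcons perm_cons perm_sym => pr.
exists r => //; rewrite mem_filter mem_permutations pr andbT.
by rewrite -(weak_cons_max (gt_k _ pr)) -yk.
Qed.

(** * Subsets of letters and binomial sums *)

(** Complementary subsets in the order of [s]: [p.2] will follow the smallest letter, [p.1] precede
    it. *)
Fixpoint splits (s : seq nat) : seq (seq nat * seq nat) :=
  if s is x :: s' then
    [seq (x :: p.1, p.2) | p <- splits s'] ++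
    [seq (p.1, x :: p.2) | p <- splits s']
  else [:: ([::], [::])].

Lemma splits_perm s p : p \in splits s -> perm_eq (p.1 ++ p.2) s.
Proof.
elim: s p => [|x s IH] p /=; first by rewrite inE => /eqP->.
rewrite mem_cat => /orP[] /mapP[q /IH qs ->] /=; first by rewrite perm_cons.
by rewrite -cat1s perm_catCA /= perm_cons.
Qed.

Lemma splits_subseq s p : p \in splits s -> subseq p.2 s.
Proof.
elim: s p => [|x s IH] p; first by rewrite inE => /eqP->.
rewrite [splits _]/= mem_cat => /orP[] /mapP[q /IH qs ->].
  exact: subseq_trans qs (subseq_cons _ _).
by rewrite /= eqxx.
Qed.

Lemma splits_filter P s : (filter (predC P) s, filter P s) \in splits s.
Proof.
elim: s => //= x s IH; rewrite mem_cat; case: (P x) => /=; apply/orP.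
  by right; apply/mapP; exists (filter (predC P) s, filter P s).
by left; apply/mapP; exists (filter (predC P) s, filter P s).
Qed.

Lemma splits_snd_uniq s : uniq s -> uniq (map snd (splits s)).
Proof.
elim: s => //= x s IH /andP[xs /IH us].
rewrite map_cat -!map_comp cat_uniq us (map_comp (cons x)).
rewrite (map_inj_uniq (f := cons x)) ?us ?andbT; last by move=> ? ? [].
apply/hasPn => _ /mapP[q _ ->]; apply: contra xs => /mapP[p /splits_subseq ps].
by move=> /= eq; apply: (mem_subseq ps); rewrite -eq mem_head.
Qed.

(** Pascal's rule followed by an index shift. *)
Lemma sum_binS (F : nat -> nat) m :
  \sum_(0 <= k < m.+2) 'C(m.+1, k) * F k =
  \sum_(0 <= k < m.+1) 'C(m, k) * (F k.+1 + F k).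
Proof.
apply/esym; rewrite [RHS]big_nat_recl // bin0.
(* The second sum gains the term [k = m + 1], whose binomial coefficient vanishes. *)
transitivity (\sum_(0 <= k < m.+1) 'C(m, k) * F k.+1 +
    \sum_(0 <= k < m.+2) 'C(m, k) * F k).
  rewrite [in RHS](@big_nat_recr _ _ _ m.+1) //= bin_small // addn0 -big_split.
  by apply: eq_bigr => k _; rewrite mulnDr.
rewrite [in X in _ + X]big_nat_recl // bin0 addnCA -big_split /=.
by congr (_ + _); apply: eq_bigr => k _; rewrite binS mulnDl addnC.
Qed.

(** Putting [x] in [p.1] turns [g] into [g \o succn], putting it in [p.2] keeps [g]: the recursion
    of [sum_binS]. *)
Lemma sum_splits (g : nat -> nat) s :
  \sum_(p <- splits s) g (size p.1) = \sum_(0 <= k < (size s).+1) 'C(size s, k) * g k.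
Proof.
elim: s g => [|x s IH] g; first by rewrite big_seq1 big_nat1 bin0 mul1n.
rewrite /= big_cat !big_map /= (IH (g \o succn)) IH.
by rewrite sum_binS -big_split; apply: eq_bigr => k _; rewrite /= mulnDr.
Qed.

(** * The cut at the smallest letter *)

Lemma ltn_head_cat0 m v : all (gtn m) v -> 0 < m -> head 0 (v ++ [:: 0]) < m.
Proof. by case: v => //= x v /andP[]. Qed.

Lemma gtn_sorted_rev_iota m n : sorted gtn (rev (iota m n)).
Proof. by rewrite rev_sorted; apply: iota_ltn_sorted. Qed.

Lemma map_uniq_inj_in (T U : eqType) (f : T -> U) s :
  uniq (map f s) -> {in s &, injective f}.
Proof.
elim: s => //= z s IH /andP[fz /IH inj] x y.
rewrite !inE => /predU1P[->|xs] /predU1P[->|ys] //; last exact: inj.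
  by move=> e; rewrite e map_f in fz.
by move=> e; rewrite -e map_f in fz.
Qed.

Lemma nstrongSS m :
  nstrong (iota 0 m.+2) = \sum_(0 <= k < m.+1) 'C(m, k) * nweak (iota 0 k.+1).
Proof.
(* [s] holds the letters strictly between 0 and [N], decreasing because words are reversed; [W p]
   lists the possible reversed first parts. *)
pose s := rev (iota 1 m); pose N := m.+1.
pose W (p : seq nat * seq nat) := [seq u <- permutations (N :: p.1) | weak u].
have s_uniq : uniq s by rewrite rev_uniq iota_uniq.
have size_s : size s = m by rewrite size_rev size_iota.
have mem_s x : (x \in s) = (0 < x < N) by rewrite mem_rev mem_iota.
have sizeW p : p \in splits s -> size (W p) = nweak (iota 0 (size p.1).+1).
  move=> /splits_perm ps; rewrite size_filter -/(nweak _) nweak_size //=.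
  have := perm_uniq ps; rewrite s_uniq cat_uniq => /andP[-> _].
  rewrite andbT; apply/negP => Np.
  by have := perm_mem ps N; rewrite mem_cat Np mem_s ltnn andbF.
have perm_W p u : p \in splits s -> u \in W p ->
    perm_eq (p.2 ++ 0 :: u) (iota 0 m.+2).
  rewrite mem_filter mem_permutations => ps /andP[_ pu].
  rewrite -[iota 0 _]/(0 :: iota 1 N) -cat1s perm_catCA cat1s perm_cons perm_catC.
  apply: (@perm_trans _ (N :: p.1 ++ p.2)); first by rewrite -cat_cons perm_cat2r.
  have -> : iota 1 N = rcons (iota 1 m) N by rewrite /N -[in LHS](addn1 m) iotaD cats1.
  rewrite perm_sym perm_rcons perm_cons perm_sym (perm_trans (splits_perm ps)) //.
  by rewrite perm_rev.
transitivity (\sum_(p <- splits s) nweak (iota 0 (size p.1).+1)); last first.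
  by rewrite (sum_splits (fun k => nweak (iota 0 k.+1))) size_s.
have -> : \sum_(p <- splits s) nweak (iota 0 (size p.1).+1) =
    size [seq p.2 ++ 0 :: u | p <- splits s, u <- W p].
  rewrite size_allpairs_dep sumnE big_map big_seq [RHS]big_seq.
  by apply: eq_bigr => p /sizeW.
rewrite /nstrong -size_filter; apply/perm_size/uniq_perm.
- by rewrite filter_uniq ?permutations_uniq.
- apply: allpairs_uniq_dep => [|p _|].
  + by apply: map_uniq (splits_snd_uniq s_uniq).
  + by rewrite filter_uniq ?permutations_uniq.
  move=> _ _ /allpairsPdep[p [u [ps pu ->]]] /allpairsPdep[q [v [qs qv ->]]] /= e.
  (* The only 0 separates [p.2] from [u], and [p.2] determines [p]. *)
  have : uniq (p.2 ++ 0 :: u).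
    by rewrite (perm_uniq (perm_W _ _ ps pu)) iota_uniq.
  move/(uniq_eqseq_pivotl q.2 v); rewrite e eqxx => /esym/andP[/eqP pq /eqP->].
  by rewrite (map_uniq_inj_in (splits_snd_uniq s_uniq) ps qs pq).
move=> r; rewrite mem_filter mem_permutations.
apply/andP/allpairsPdep => [[sr pr]|[p [u [ps]]]].
  have r0 : 0 \in r by rewrite (perm_mem pr) mem_iota.
  have r_uniq : uniq r by rewrite (perm_uniq pr) iota_uniq.
  case/splitPr: r0 r_uniq sr pr => v u r_uniq sr pr.
  move: r_uniq; rewrite -cat1s uniq_catCA /= mem_cat negb_or cat_uniq -andbA.
  move=> /and5P[v0 u0 v_uniq uv u_uniq].
  have vu_gt0 : all (ltn 0) (v ++ u).
    apply/allP => x; rewrite /= lt0n mem_cat.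
    by apply: contraTneq => ->; rewrite negb_or v0.
  have mem_vu x : 0 < x -> (x \in v) || (x \in u) = (x <= N).
    move=> x_gt0; move: (perm_mem pr x).
    by rewrite mem_iota mem_cat inE [x == 0]eqn0Ngt x_gt0.
  move: sr; rewrite strong_cat0 // => /and3P[wu v_sorted /hasP[z zu lt_z]].
  have z_gt0 : 0 < z by apply: leq_trans lt_z.
  have zN : z <= N by rewrite -mem_vu // zu orbT.
  (* [v] is bounded by its head, which is below [z <= N]; so [N] must lie in [u]. *)
  have vN : all (gtn N) v.
    apply: (@sub_all _ (geq (head 0 (v ++ [:: 0])))) => [x /= xh|].
      by apply: leq_trans zN; apply: leq_ltn_trans lt_z.
    case: (v) v_sorted => //= x v'; rewrite leqnn /= => /(order_path_min gtn_trans).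
    by rewrite all_cat => /andP[+ _]; apply: sub_all => y /ltnW.
  have Nu : N \in u.
    have := mem_vu N isT; rewrite leqnn => /orP[/(allP vN)/=|//].
    by rewrite ltnn.
  (* Both lists are strictly decreasing with the same letters. *)
  have vE : filter (mem v) s = v.
    apply: (irr_sorted_eq gtn_trans) => [x /=| | |x].
    - by rewrite ltnn.
    - by rewrite sorted_filter ?gtn_sorted_rev_iota //; apply: gtn_trans.
    - by case: (v) v_sorted => //= y v'; rewrite cat_path => /andP[].
    rewrite mem_filter mem_s andb_idr // => /= xv.
    have /= -> := allP vN x xv; rewrite andbT lt0n.
    by apply: contraTneq xv => ->.
  exists (filter (predC (mem v)) s, filter (mem v) s), u.
  rewrite splits_filter /= vE mem_filter wu mem_permutations; split=> //.
  apply: uniq_perm => // [|x].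
    by rewrite /= filter_uniq // mem_filter mem_s ltnn /= !andbF.
  rewrite inE mem_filter mem_s /=.
  have [xv|xv] := boolP (x \in v); rewrite /= ?orbF.
    have /= := allP vN x xv; rewrite ltn_neqAle => /andP[/negbTE-> _].
    by apply/negbTE/negP => xu; case/negP: uv; apply/hasP; exists x.
  have [->|x_gt0] := posnP x; first exact/negbTE.
  by move: (mem_vu x x_gt0); rewrite (negbTE xv) leq_eqVlt.
move=> uW ->; split; last exact: perm_W.
move: uW; rewrite mem_filter mem_permutations => /andP[wu pu].
have vN : all (gtn N) p.2.
  by apply/allP => x /(mem_subseq (splits_subseq ps)); rewrite mem_s => /andP[].
  rewrite strong_cat0 ?wu /=.
    apply/andP; split; last first.
      apply/hasP; exists N; first by rewrite (perm_mem pu) mem_head.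
      exact: ltn_head_cat0.
    apply: (subseq_sorted gtn_trans) (gtn_sorted_rev_iota 0 m.+1).
    by rewrite /= rev_cons -cats1 cat_subseq ?splits_subseq.
  apply/allP => x; rewrite mem_cat (perm_mem pu) !inE => xin.
  have [/eqP->//|xN] := boolP (x == N).
  have : x \in s by rewrite -(perm_mem (splits_perm ps)) mem_cat orbC; move: xin; rewrite (negbTE xN).
  by rewrite mem_s => /andP[].
Qed.

(** * From pattern avoidance to conditions on words *)

Section AvoidingWords.

Variable n : nat.
Implicit Types (s p : 'S_n) (w u v : seq 'I_n) (x y z : 'I_n).

(* Inside a cycle the letter following x is its image; the last letter of a
   cycle is sent to the head, which is the largest letter seen so far, and is
   followed by a left-to-right maximum or by nothing. *)
Lemma theta_word_next s u x v : theta_word s = u ++ x :: v ->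
     (exists2 z, z \in rcons u x & s x < z) /\ (exists v', v = s x :: v')
  \/ [/\ s x \in rcons u x, forall z, z \in rcons u x -> z <= s x &
         forall y v', v = y :: v' -> forall z, z \in rcons u x -> z < y].
Proof.
move=> word_eq; have [m mm xm] := mem_std_cycle_form s x.
have [bs1 [bs2 bsE]] : exists bs1 bs2,
    std_cycle_form s = bs1 ++ cycle_from s m :: bs2.
  have : cycle_from s m \in std_cycle_form s.
    by apply: map_f; rewrite mem_filter mm mem_enum.
  by case/splitPr => bs1 bs2; exists bs1, bs2.
have [c1 [c2 cE]] : exists c1 c2, cycle_from s m = c1 ++ x :: c2.
  by case/splitPr: xm => c1 c2; exists c1, c2.
have := theta_word_uniq s; rewrite word_eq.
(* As [x] occurs once, the cut of the concatenated cycles at [x] is unique. *)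
move=> /(uniq_eqseq_pivotl (flatten bs1 ++ c1) (c2 ++ flatten bs2)).
rewrite -word_eq /theta_word bsE flatten_cat /= cE -!catA eqxx.
move=> /esym/andP[/eqP uE /eqP vE].
have := std_cycle_form_sorted s; rewrite bsE pairwise_cat /=.
move=> /and3P[lt1 _ /andP[lt2 _]].
have := std_cycle_form_blocks s; rewrite bsE all_cat /=.
move=> /and3P[max1 _ max2].
have sub_c z : z \in rcons c1 x -> z \in cycle_from s m.
  by rewrite cE mem_rcons mem_cat !inE => /orP[->|->]; rewrite ?orbT.
have m_c1 : m \in rcons c1 x.
  by move: (cE); rewrite cycle_from_cons; case: (c1) => [|? ?] [-> _]; rewrite mem_head.
(* Cycle heads increase and each is the largest of its cycle. *)
have le_m z : z \in rcons u x -> z <= m.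
  rewrite uE -cats1 -catA cats1 mem_cat => /orP[/flattenP[b bb1 zb]|/sub_c]; last first.
    by rewrite mem_cycle_from; apply: (forall_inP mm).
  have := allrelP lt1 b (cycle_from s m) bb1 (mem_head _ _).
  have := allP max1 b bb1; rewrite cycle_from_cons.
  case: b zb {bb1} => // h b; rewrite inE => /predU1P[->|zb] /= /allP hb; first exact: ltnW.
  by move/ltnW; apply: leq_trans; apply/ltnW/hb.
have m_u : m \in rcons u x.
  by rewrite uE -cats1 -catA cats1 mem_cat m_c1 orbT.
have := cycle_fromP s m.
rewrite cE cycle_catC /=.
(* Either the image of [x] follows it in the cycle, or [x] closes the cycle and is sent to [m]. *)
case: c2 => [|y c2] in cE vE *; last first.
  move=> /= /andP[/eqP sx _]; left; rewrite sx; split; last by exists (c2 ++ flatten bs2).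
  exists m => //.
  have ym : y <= m by apply: (forall_inP mm); rewrite -mem_cycle_from cE mem_cat !inE eqxx !orbT.
  rewrite ltn_neqAle ym andbT; apply/negP => /eqP/val_inj ym'.
  have := theta_word_uniq s; rewrite word_eq -cat_rcons cat_uniq => /and3P[_ /hasP[]].
  by exists y; rewrite ?ym' // vE -ym' mem_head.
move=> sx; right.
have -> : s x = m.
  move: cE sx; rewrite cycle_from_cons.
  by case: (c1) => [|h c] [-> _] /= /andP[/eqP].
split=> // y v' vy z /le_m zm; apply: leq_ltn_trans zm _.
have := vE; rewrite vy /= => bs2E.
case: bs2 lt2 max2 bs2E {bsE vE lt1} => [|b bs2] //= /andP[mb _] /andP[].
by move: mb; rewrite cycle_from_cons; case: b => //= h b mh _ _ [->].
Qed.

Lemma weakP w : reflect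
  (forall u y v, w = u ++ y :: v -> step (rev (map val u)) y)
  (weak (rev (map val w))).
Proof.
apply: (iffP idP) => [|step_w].
  elim/last_ind: w => [_ [] //|w x IH]; rewrite map_rcons rev_rcons /=.
  move=> /andP[step_x weak_w] u y v; case/lastP: v => [|v z] /eqP.
    by rewrite cats1 eqseq_rcons => /andP[/eqP<- /eqP<-].
  rewrite -rcons_cons -rcons_cat eqseq_rcons => /andP[/eqP w_eq _].
  exact: IH w_eq.
elim/last_ind: w step_w => // w x IH step_w; rewrite map_rcons rev_rcons /=.
rewrite (step_w w x [::]) ?cats1 // IH // => u y v w_eq.
by apply: (step_w u y (rcons v x)); rewrite w_eq rcons_cat.
Qed.

Lemma exceeded_rcons u x :
  reflect (exists2 z, z \in rcons u x & x < z) (exceeded (rev (map val (rcons u x)))).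
Proof.
rewrite /exceeded has_rev has_map map_rcons rev_rcons.
by apply: (iffP hasP) => -[z zu xz]; exists z.
Qed.

Lemma step_rcons u x y : reflect
  ((forall z, z \in rcons u x -> y < z) \/
   (exists2 z, z \in rcons u x & x < z) /\ x < y)
  (step (rev (map val (rcons u x))) y).
Proof.
rewrite /step all_rev all_map (_ : head 0 _ = val x); last first.
  by rewrite map_rcons rev_rcons.
apply: (iffP orP) => [[/allP lt_y|/andP[/exceeded_rcons ? ?]]|
                      [lt_y|[/exceeded_rcons-> ->]]].
- by left.
- by right.
- by left; apply/allP.
by right.
Qed.

Lemma hatK p : theta (hat p) = p.
Proof. exact: f_invF. Qed.

Lemma mem_theta_word s x : x \in theta_word s.
Proof.
have [m mm xm] := mem_std_cycle_form s x.
apply/flattenP; exists (cycle_from s m) => //.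
by apply: map_f; rewrite mem_filter mm mem_enum.
Qed.

(** The word of [hat p] is the one-line form of [p], so each letter sits at its image under the
    inverse of [p]. *)
Lemma mem_theta_word_prefix p u v x y : theta_word (hat p) = u ++ y :: v ->
  (x \in u) = ((p^-1)%g x < (p^-1)%g y).
Proof.
have index_word z : index z (theta_word (hat p)) = (p^-1)%g z.
  rewrite theta_wordE hatK -[in LHS](permKV p z) index_map ?index_enum_ord //.
  exact: perm_inj.
move=> word_eq; have := theta_word_uniq (hat p).
rewrite word_eq uniq_catC /= mem_cat negb_or => /andP[/andP[_ yu] _].
rewrite -!index_word word_eq !index_cat (negbTE yu) /= eqxx addn0.
by case: ifP => [xu|_]; rewrite ?index_mem // ltnNge leq_addr.
Qed.

Lemma avoids_1_11P p : reflect (forall x, hat p x != x) (avoids pat_1_11 p).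
Proof.
apply: (iffP idP) => [p_avoids x | no_fix]; last first.
  apply/existsP => -[x /existsP[t /and4P[_ _ _ /forall_inP]]].
  by move/(_ _ (set11 _)); apply/negP; apply: no_fix.
apply: contraNneq p_avoids => fix_x; apply/existsP; exists [ffun=> x].
apply/existsP; exists [ffun=> (p^-1)%g x]; apply/and4P; split.
- by apply/forallP => i; apply/forallP => j; rewrite !ord1.
- by apply/forallP => i; apply/forallP => j; case: i j => [[|//] ?] [[|//] ?].
- by apply/forallP => j; rewrite !ffunE permKV.
by apply/forall_inP => bc _; rewrite !ffunE fix_x.
Qed.

Lemma avoids_12_32P p : reflect
  (forall u v x1 x2 x3, theta_word (hat p) = u ++ x2 :: v -> x1 \in u ->
     x1 < x2 -> x2 < x3 -> hat p x3 != x2)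
  (avoids pat_12_32 p).
Proof.
apply: (iffP idP) => [p_avoids u v x1 x2 x3 word_eq x1u lt12 lt23 | no_occ].
  apply: contraNneq p_avoids => arrow; apply/existsP.
  exists [ffun i => tnth [tuple x1; x2; x3] i]; apply/existsP.
  exists [ffun j => (p^-1)%g (tnth [tuple x1; x2] j)]; apply/and4P; split.
  - apply/forallP => i; apply/forallP => j; rewrite !ffunE.
    case: i j => [[|[|[|//]]] ?] [[|[|[|//]]] ?] //=.
    by rewrite (ltn_trans lt12).
  - apply/forallP => i; apply/forallP => j; rewrite !ffunE.
    case: i j => [[|[|//]] ?] [[|[|//]] ?] //=.
    by rewrite -(mem_theta_word_prefix _ word_eq).
  - by apply/forallP => -[[|[|//]] ?]; rewrite !ffunE permKV.
  by apply/forall_inP => bc /set1P->; rewrite !ffunE arrow.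
apply/existsP => -[x /existsP[t /and4P[/forallP x_lt /forallP t_lt /forallP word_x /forall_inP]]].
move/(_ _ (set11 _)); apply/negP.
have [u [v word_eq]] : exists u v, theta_word (hat p) = u ++ x (@label 3 2 isT) :: v.
  by case/splitPr: (mem_theta_word (hat p) (x (@label 3 2 isT))) => u v; exists u, v.
have lt2 (i j : 'I_3) : i < j -> x i < x j by move/forallP/(_ j)/implyP: (x_lt i); apply.
apply: (no_occ u v (x (@label 3 1 isT))) => //; try exact: lt2.
rewrite (mem_theta_word_prefix _ word_eq).
have /eqP <- := word_x (@Ordinal 2 0 isT); have /eqP <- := word_x (@Ordinal 2 1 isT).
by rewrite !permK; move/forallP/(_ (@Ordinal 2 1 isT))/implyP: (t_lt (@Ordinal 2 0 isT)); apply.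
Qed.

Lemma avoidsE p : avoids pat_12_32 p && avoids pat_1_11 p =
  strong (rev (map val (theta_word (hat p)))).
Proof.
set s := hat p; set w := theta_word s.
have disj u x v : w = u ++ x :: v -> x \notin v /\ {in rcons u x, forall z, z \notin v}.
  move=> w_eq; have := theta_word_uniq s; rewrite -/w w_eq -cat_rcons cat_uniq.
  move=> /and3P[_ /hasPn uv _].
  have uv' : {in rcons u x, forall z, z \notin v}.
    by move=> z zu; apply/negP => /uv; rewrite zu.
  by split=> //; apply: uv'; rewrite mem_rcons mem_head.
have split_at x : exists u v, w = u ++ x :: v.
  by rewrite /w; case/splitPr: (mem_theta_word s x) => u v; exists u, v.
apply/andP/andP => [[/avoids_12_32P no_12_32 /avoids_1_11P no_fix]|[/weakP step_w last_w]].
  (* When [x] closes its cycle, its image is the largest letter so far, and differs from [x] by the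
     absence of fixed points. *)
  have above u x : s x \in rcons u x -> (forall z, z \in rcons u x -> z <= s x) ->
      exists2 z, z \in rcons u x & x < z.
    move=> sx_u max_sx; exists (s x) => //.
    rewrite ltn_neqAle max_sx ?mem_rcons ?mem_head // andbT eq_sym.
    exact: no_fix.
  split.
    apply/weakP => u y v; case/lastP: u => // u x w_eq; apply/step_rcons.
    have w_eq' : w = u ++ x :: y :: v by rewrite w_eq cat_rcons.
    case: (theta_word_next w_eq') => [[[z zu ltz] [v' [yE _]]]|[sx_u max_sx lt_y]].
      (* In a descent to [y = s x], a smaller letter before [y] would complete an occurrence of the
         pattern. *)
      rewrite -yE in ltz; have [lt_yx|le_xy] := ltnP y x.
        left=> t tu; rewrite ltnNge leq_eqVlt; apply/negP => /orP[/eqP/val_inj ty|lt_ty].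
          by have [_ /(_ t tu)] := disj _ _ _ w_eq'; rewrite ty mem_head.
        by have := no_12_32 _ _ _ _ _ w_eq tu lt_ty lt_yx; rewrite yE eqxx.
      have lt_xy : x < y.
        rewrite ltn_neqAle le_xy andbT eq_sym yE; exact: no_fix.
      by right; split=> //; exists z => //; apply: ltn_trans ltz.
    right; split; first exact: above.
    by apply: lt_y => //; rewrite mem_rcons mem_head.
  have [->//|[u [x w_eq]]] : w = [::] \/ exists u x, w = rcons u x.
    by case/lastP: (w) => [|u x]; [left | right; exists u, x].
  have w_eq' : w = u ++ [:: x] by rewrite w_eq cats1.
  apply/orP; right; rewrite w_eq; apply/exceeded_rcons.
  by case: (theta_word_next w_eq') => [[_ [v' //]]|[sx_u max_sx _]]; apply: above.
split; [apply/avoids_12_32P; rewrite -/s -/w => u v x1 x2 x3 w_eq x1u lt12 lt23 | apply/avoids_1_11P => x].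
  (* As [x3] is sent to a smaller letter, [x2] follows it immediately; this descent must reach a new
     minimum, against [x1]. *)
  apply/eqP; rewrite -/s => sx; have [u3 [v3 w_eq3]] := split_at x3.
  case: (theta_word_next w_eq3) => [[_ [v' v3E]]|[_ /(_ x3)]]; last first.
    by rewrite mem_rcons mem_head sx leqNgt lt23 => /(_ isT).
  have : uniq w := theta_word_uniq s; rewrite w_eq => /(uniq_eqseq_pivotl (rcons u3 x3) v').
  rewrite -w_eq w_eq3 v3E sx cat_rcons eqxx => /esym/andP[/eqP uE _].
  have /step_rcons[/(_ x1)|[_]] : step (rev (map val (rcons u3 x3))) x2.
  - by apply: (step_w _ _ v); rewrite -uE.
  - by rewrite -uE x1u ltnNge (ltnW lt12) => /(_ isT).
  by rewrite ltnNge (ltnW lt23).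
(* A fixed point is a left-to-right maximum followed by another one or by the end, which [strong]
   excludes. *)
apply/eqP; rewrite -/s => sx; have [u [v w_eq]] := split_at x.
case: (theta_word_next w_eq) => [[_ [v' vE]]|[_ max_x lt_y]].
  by have [] := disj _ _ _ w_eq; rewrite vE sx mem_head.
have not_above : ~ exists2 z, z \in rcons u x & x < z.
  by case=> z /max_x; rewrite sx leqNgt => /negP.
case: v => [|y v] in w_eq lt_y *.
  move: last_w; rewrite w_eq cats1 => /orP[|/exceeded_rcons //].
  by rewrite map_rcons rev_rcons.
have /step_rcons[/(_ x)|[//]] : step (rev (map val (rcons u x))) y.
  by apply: (step_w _ _ v); rewrite cat_rcons.
have xu : x \in rcons u x by rewrite mem_rcons mem_head.
by move/(_ xu); rewrite ltnNge ltnW ?(lt_y _ _ erefl x).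
Qed.

End AvoidingWords.

(** Taking the reversed one-line word of [p] is injective, hence bijective since both sides have n!
    elements; [avoidsE] matches the conditions. *)
Lemma aE n : a n = nstrong (iota 0 n).
Proof.
pose word (p : 'S_n) := rev (map val (theta_word (hat p))).
have perm_word : perm_eq (map word (enum {: 'S_n})) (permutations (iota 0 n)).
  have word_uniq : uniq (map word (enum {: 'S_n})).
    rewrite map_inj_uniq ?enum_uniq // => p q /(can_inj revK)/(inj_map val_inj).
    rewrite !theta_wordE !hatK => eq_pq; apply/permP => i.
    by have /eq_in_map/(_ i (mem_enum _ i)) := eq_pq.
  have sub_word : {subset map word (enum {: 'S_n}) <= permutations (iota 0 n)}.
    move=> _ /mapP[p _ ->]; rewrite mem_permutations perm_rev -val_enum_ord.
    apply/perm_map/uniq_perm; rewrite ?theta_word_uniq ?enum_uniq // => x.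
    by rewrite mem_theta_word mem_enum.
  apply: uniq_perm => //; first exact: permutations_uniq.
  case: (uniq_min_size word_uniq sub_word) => //.
  by rewrite size_map -cardE card_Sn size_permutations ?iota_uniq ?size_iota.
rewrite /nstrong -(seq.permP perm_word) count_map enumT.
rewrite /a cardsE cardE /enum_mem size_filter.
by apply: eq_count => p; apply: avoidsE.
Qed.

Theorem theorem6p7 :
  [/\ a 0 = 1,
      a 1 = 0
    & forall n : nat, 2 <= n ->
        a n = \sum_(2 <= k < n.+1) 'C(n - 2, k - 2) * (a (k - 1) + a (k - 2))
        /\ a n = \sum_(0 <= k < n) 'C(n - 1, k) * a k].
Proof.
rewrite !aE; split=> // -[|[|m]] // _.
(* This is the first formula with [k] shifted by 2; Pascal's rule then gives the second. *)
have a_rec : a m.+2 = \sum_(0 <= k < m.+1) 'C(m, k) * (a k.+1 + a k).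
  rewrite aE nstrongSS; apply: eq_bigr => k _.
  by rewrite nweakS !aE.
split.
  rewrite a_rec big_add1 /= big_add1 /=.
  by apply: eq_bigr => k _; rewrite !subSS !subn0.
by rewrite a_rec subn1 /= sum_binS.
Qed.
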